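(* Let $G$ be a countable group generated by a non-empty finite set $S$. Then the undirected right Cayley graph of $G$ with respect to $S$ can be nonrepetitively colored with $\lceil 4|S|^2+16|S|^{5/3}\rceil$ colors. Moreover, if $G$ is infinite and amenable and $X$ is the subshift of nonrepetitive colorings of this graph with an alphabet of $\lceil 4|S|^2+16|S|^{5/3}\rceil$ colors, then $$\alpha(X)\ge4|S|^2+12|S|^{5/3}.$$
   Context: The undirected right Cayley graph of $G$ with respect to $S$ has vertex set $G$ and an edge between $g$ and $gs$ for every $g\in G$ and $s\in S$ (loops are ignored). A coloring $c:V\to\mathcal{A}$ of the vertices of a graph is nonrepetitive if there is no path $v_1v_2\ldots v_{2n}$ ($n\ge1$, vertices pairwise distinct, consecutive vertices adjacent) with $c(v_i)=c(v_{n+i})$ for all $i\in\{1,\ldots,n\}$. The set of nonrepetitive colorings $G\to\mathcal{A}$ is a subshift $X\subseteq\mathcal{A}^G$. For finite non-empty $T\subseteq G$, a pattern $p\in\mathcal{A}^T$ appears in $x\in\mathcal{A}^G$ if there is $g\in G$ with $x(gt)=p(t)$ for all $t\in T$; let $\mathcal{G}^{(T)}$ be the set of $p\in\mathcal{A}^T$ that appear in some $x\in X$. The growth of $X$ is $\alpha(X)=\lim_{n\to\infty}\big(\min_{T\subseteq G,|T|=n}|\mathcal{G}^{(T)}|\big)^{1/n}$ (the limit exists). *)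

(* Defs.v *)
From HB Require Import structures.
From mathcomp Require Import all_boot all_order all_algebra.
From mathcomp Require Import finmap.
From mathcomp Require Import all_classical all_reals all_analysis.
Set Implicit Arguments.
Unset Strict Implicit.
Unset Printing Implicit Defensive.
Import Order.TTheory GRing.Theory Num.Theory.
Import numFieldNormedType.Exports.
Local Open Scope classical_set_scope.
Local Open Scope fset_scope.
Local Open Scope ring_scope.

Definition is_subgroup (G : groupType) (H : set G) : Prop :=
  H 1%g /\ forall x y : G, H x -> H y -> H (x / y)%g.

Definition generated_by (G : groupType) (S : {fset G}) : Prop :=
  smallest (@is_subgroup G) [set` S] = [set: G].

Definition cayley (G : groupType) (S : {fset G}) : rel G :=
  fun g h => (g != h) &&
    [exists s : S, (h == g * val s)%g || (g == h * val s)%g].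

Definition nonrepetitive (V : eqType) (e : rel V) (A : Type) (c : V -> A)
    : Prop :=
  ~ exists (n : nat) (v : seq V),
      [/\ (0 < n)%N, size v = n.*2, uniq v, sorted e v &
          map c (take n v) = map c (drop n v)].

Definition nonrepetitive_shift (G : groupType) (S : {fset G}) (A : Type)
    : set (G -> A) :=
  [set x | nonrepetitive (cayley S) x].

Section Growth.
Context (R : realType) (G : groupType) (A : finType).

Definition appears (T : {fset G}) (p : {ffun T -> A}) (x : G -> A) : Prop :=
  exists g : G, forall t : T, x (g * val t)%g = p t.

Definition patterns (X : set (G -> A)) (T : {fset G}) : {set {ffun T -> A}} :=
  [set p | `[< exists2 x, X x & appears p x >]].

(* The minimum of #|patterns X T| over the T of cardinality n; the default
   value 0 is only used when there is no such T, that is, when n exceeds the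
   order of a finite G. *)
Definition min_patterns (X : set (G -> A)) (n : nat) : nat :=
  xget 0%N [set m : nat |
    (exists2 T : {fset G}, #|` T| = n & #|patterns X T| = m) /\
    (forall T : {fset G}, #|` T| = n -> (m <= #|patterns X T|)%N)].

Definition growth_seq (X : set (G -> A)) : R^nat :=
  fun n => (min_patterns X n)%:R `^ (n%:R^-1).

Definition growth (X : set (G -> A)) : R := lim (growth_seq X @ \oo).

End Growth.

(* Right Foelner sequences; a left one is obtained from a right one by
   inverting its sets, and conversely. *)
Definition amenable (R : realType) (G : groupType) : Prop :=
  exists F : nat -> {fset G},
    (forall n, F n != fset0) /\
    forall g : G,
      (fun n => let Fg := [fset (x * g)%g | x in F n] in
         #|` (F n `\` Fg) `|` (Fg `\` F n)|%:R / #|` F n|%:R : R)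
        @ \oo --> (0 : R).

(* Main.v *)
(* Let b = 4|S|^2 + 12|S|^(5/3). Rosenfeld's counting argument: for a finite set
   W of vertices and v outside W, there are at least b times as many
   nonrepetitive colorings of v |: W as of W. By induction on W, discarding from
   the |A| extensions of each coloring of W those that create a repetition
   through v costs at most n (2|S|)^(2n-1) b^(1-n) per coloring of W for paths
   with 2n vertices, since the half containing v is determined by the other half.

   A coloring of a finite T' is determined by its restrictions to T and to its
   complement in T', so the nonrepetitive colorings of T' have at least b^|T|
   distinct restrictions to T. By compactness some T' is such that all of these
   extend to the whole group. Fekete's lemma gives the existence of the growth;
   it applies because in an infinite group two finite sets have disjoint
   translates. *)
Require Import Defs.
From HB Require Import structures.
From mathcomp Require Import all_boot all_order all_algebra.
From mathcomp Require Import boolp zify ring lra.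
Set Implicit Arguments.
Unset Strict Implicit.
Unset Printing Implicit Defensive.
Import Order.TTheory GRing.Theory Num.Theory.

(** * Counting nonrepetitive colorings of a finite graph *)

Section Repetition.
Context (V A : eqType) (e : rel V).
Implicit Types (f g : V -> A) (s : seq V).

Definition repetition f s :=
  [&& s != [::], uniq s, sorted e s, ~~ odd (size s) &
      map f (take (size s)./2 s) == map f (drop (size s)./2 s)].

Lemma nonrepetitiveP f : nonrepetitive e f <-> forall s, ~~ repetition f s.
Proof.
split=> [fP s|fP [n [s [n0 sz us es ef]]]].
  apply/negP => /and5P[s0 us es os /eqP ef]; apply: fP.
  exists (size s)./2, s; split=> //; last by rewrite even_halfK.
  by case: s s0 us es os ef => [|x [|y s]].
move/negP: (fP s); apply; apply/and5P; split=> //.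
- by case: s sz {us es ef} => //; case: n n0.
- by rewrite sz odd_double.
- by rewrite sz doubleK ef.
Qed.

Lemma eq_in_repetition f g s :
  {in s, f =1 g} -> repetition f s = repetition g s.
Proof.
move=> fg; rewrite /repetition; congr [&& _, _, _, _ & _ == _].
  by apply/eq_in_map => x /mem_take /fg.
by apply/eq_in_map => x /mem_drop /fg.
Qed.

(** Reversal exchanges the two halves, so a given vertex of a repetition may be assumed to lie in
    the first half. *)
Lemma repetition_rev f s :
  symmetric e -> repetition f s -> repetition f (rev s).
Proof.
move=> e_sym /and5P[s0 us es os /eqP ef]; apply/and5P; split.
- by rewrite -size_eq0 size_rev size_eq0.
- by rewrite rev_uniq.
- by rewrite rev_sorted (eq_sorted (e' := e)) // => x y; rewrite e_sym.
- by rewrite size_rev.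
rewrite size_rev take_rev drop_rev !map_rev.
have -> : size s - (size s)./2 = (size s)./2.
  by rewrite -{1}(even_halfK os) -addnn addnK.
by rewrite ef.
Qed.

End Repetition.

(** * Enumerating walks in a graph of bounded degree *)

Section Walks.
Context (V : finType) (e : rel V) (D : nat).
Hypothesis deg_e : forall x, #|e x| <= D.

(** The start [x] is left out of each list, and walks that revisit vertices are kept, so the count
    depends on degrees alone. *)
Fixpoint walks n (x : V) : seq (seq V) :=
  if n is n'.+1 then [seq y :: s | y <- enum (e x), s <- walks n' y]
  else [:: [::]].

Lemma mem_walks n x s : path e x s -> size s = n -> s \in walks n x.
Proof.
elim: n x s => [|n IH] x [|y s] //= /andP[exy ys] [sz].
apply/allpairsPdep; exists y, s; split=> //; first by rewrite mem_enum.
exact: IH.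
Qed.

Lemma size_walks n x : size (walks n x) <= D ^ n.
Proof.
elim: n x => [|n IH] x //=; rewrite size_allpairs_dep expnS.
apply: (@leq_trans (#|e x| * D ^ n)); last by rewrite leq_mul2r deg_e orbT.
rewrite cardE; elim: (enum _) => //= y l IHl.
by rewrite mulSn leq_add.
Qed.

(* Contains the paths on [n.*2] vertices that meet [v] in their first half. *)
Definition paths_through n (v : V) : seq (seq V) :=
  [seq s | i <- iota 0 n,
           s <- [seq rev s1 ++ v :: s2 | s1 <- walks i v,
                                         s2 <- walks (n.*2.-1 - i) v]].

(** There are [n] positions for [v]; for each of them the two walks leaving [v] have total length
    [2n - 1]. *)
Lemma size_paths_through n v : size (paths_through n v) <= n * D ^ n.*2.-1.
Proof.
rewrite /paths_through size_allpairs_dep -[X in X * _](size_iota 0 n).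
have : {in iota 0 n, forall i, i < n} by move=> i; rewrite mem_iota.
elim: (iota 0 n) => //= i l IHl ltl; rewrite mulSn leq_add //; last first.
  by apply: IHl => j jl; apply: ltl; rewrite inE jl orbT.
have in_ : i < n by apply: ltl; rewrite inE eqxx.
rewrite size_allpairs.
have -> : n.*2.-1 = i + (n.*2.-1 - i) by lia.
by rewrite expnD addKn leq_mul ?size_walks.
Qed.

Lemma mem_paths_through n v s : symmetric e ->
  sorted e s -> size s = n.*2 -> v \in take n s -> s \in paths_through n v.
Proof.
move=> e_sym es sz vs; pose i := index v s.
have vs' : v \in s := mem_take vs.
have in_ : i < n.
  have vi : index v (take n s) < n.
    by apply: leq_trans (geq_minl n (size s)); rewrite -size_take_min index_mem.
  rewrite /i -{1}(cat_take_drop n s) index_cat vs //.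
have sE : s = rev (rev (take i s)) ++ v :: drop i.+1 s.
  by rewrite revK -{1}(cat_take_drop i s) (drop_nth v) ?index_mem// nth_index.
apply/allpairsPdep; exists i, s; split=> //; first by rewrite mem_iota.
apply/allpairsP; exists (rev (take i s), drop i.+1 s); split=> //=.
  apply: mem_walks; last by rewrite size_rev size_takel // sz; lia.
  move: es; rewrite {1}sE revK sorted_cat_cons => /andP[+ _].
  rewrite -rev_sorted rev_rcons /= => h.
  by rewrite (eq_path (e' := fun x y => e y x)) // => x y; rewrite e_sym.
apply: mem_walks; last by rewrite size_drop sz; lia.
by move: es; rewrite {1}sE sorted_cat_cons => /andP[].
Qed.

End Walks.

(** * Colorings of vertex sets and their extensions by one vertex *)

Section Counting.
Context (V A : finType) (e : rel V) (a0 : A) (D : nat).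
Hypothesis e_sym : symmetric e.
Hypothesis deg_e : forall x, #|e x| <= D.
Implicit Types (W U : {set V}) (f g : {ffun V -> A}).

(* Colorings of [W] are represented by total functions equal to [a0] off [W]. *)
Definition reset W f : {ffun V -> A} := [ffun x => if x \in W then f x else a0].

Definition colorings W : {set {ffun V -> A}} :=
  [set f | (reset W f == f) &&
     `[< forall s, {subset s <= W} -> ~~ repetition e f s >]].

Lemma coloringsP W f : reflect
  (reset W f = f /\ forall s, {subset s <= W} -> ~~ repetition e f s)
  (f \in colorings W).
Proof.
by rewrite inE; apply: (iffP andP) => -[h1 h2]; split;
  [exact/eqP | exact/asboolP | exact/eqP | exact/asboolP].
Qed.

Lemma reset_reset U W f : U \subset W -> reset U (reset W f) = reset U f.
Proof.
move=> /subsetP UW; apply/ffunP => x; rewrite !ffunE.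
by case: ifP => // /UW ->.
Qed.

Lemma reset_id U f : reset U (reset U f) = reset U f.
Proof. exact: reset_reset. Qed.

Lemma repetition_reset W f s : {subset s <= W} ->
  repetition e (reset W f) s = repetition e f s.
Proof. by move=> sW; apply: eq_in_repetition => x /sW xW; rewrite ffunE xW. Qed.

Lemma reset_coloring U W f : U \subset W ->
  reset W f \in colorings W -> reset U f \in colorings U.
Proof.
move=> UW /coloringsP[_ fW]; apply/coloringsP; split; first exact: reset_id.
move=> s sU; rewrite repetition_reset // -(repetition_reset (W := W)).
  by apply: fW => x /sU /(subsetP UW).
by move=> x /sU /(subsetP UW).
Qed.

Lemma card_colorings0 : #|colorings set0| = 1%N.
Proof.
rewrite (_ : colorings set0 = [set [ffun=> a0]]) ?cards1 //.
apply/setP => f; rewrite in_set1; apply/coloringsP/eqP.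
  by move=> [<- _]; apply/ffunP => x; rewrite !ffunE inE.
move=> ->; split; first by apply/ffunP => x; rewrite !ffunE inE.
move=> [|x s] sW //.
by have := sW x; rewrite !inE eqxx => /(_ isT).
Qed.

Definition extensions v W : {set {ffun V -> A}} :=
  [set f | (reset (v |: W) f == f) && (reset W f \in colorings W)].

Lemma card_extensions v W : v \notin W ->
  #|A| * #|colorings W| <= #|extensions v W|.
Proof.
move=> vW.
pose h (p : A * {ffun V -> A}) : {ffun V -> A} :=
  [ffun x => if x == v then p.1 else p.2 x].
have resh p : reset W p.2 = p.2 -> reset W (h p) = p.2.
  move=> p2; apply/ffunP => x; rewrite -[in RHS]p2 !ffunE.
  by case: ifP => // xW; case: eqP xW vW => // -> ->.
rewrite -(cardsT A) -cardsX -(card_in_imset (f := h)).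
  apply/subset_leq_card/subsetP => _ /imsetP[[a f] /setXP[_ fW] ->].
  have /coloringsP[f2 _] := fW.
  rewrite inE resh // fW andbT; apply/eqP/ffunP => x; rewrite !ffunE !inE.
  case: eqP => //= _; rewrite -[in RHS]f2 ffunE.
  by case: ifP.
move=> [a f] [b g] /setXP[_ /coloringsP[/= fW _]] /setXP[_ /coloringsP[/= gW _]].
move=> hh; congr pair; first by have /ffunP/(_ v) := hh; rewrite !ffunE eqxx.
by rewrite -[LHS](resh (a, f)) // hh resh.
Qed.

Definition bad_extensions v W n (s : seq V) : {set {ffun V -> A}} :=
  [set f in extensions v W | [&& repetition e f s, all (mem (v |: W)) s,
    size s == n.*2 & v \in take n s]].

(* The half of [s] containing [v] is determined by the other half. *)
Lemma card_bad_extensions v W n s : v \notin W ->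
  #|bad_extensions v W n s| <= #|colorings (W :\: [set x in take n s])|.
Proof.
move=> vW; set H := [set x in take n s].
have HW : W :\: H \subset W := subsetDl _ _.
rewrite -(card_in_imset (f := reset (W :\: H))).
  apply/subset_leq_card/subsetP => _ /imsetP[f + ->].
  rewrite inE => /andP[]; rewrite inE => /andP[_ fW] _.
  exact: reset_coloring HW fW.
move=> f g; rewrite !inE => /andP[/andP[/eqP fW _] /and4P[fs _ /eqP sz vs]].
move=> /andP[/andP[/eqP gW _] /and4P[gs _ _ _]] /ffunP efg.
(* As [v] lies in [H], a vertex off [H] is either in [W :\: H], where the restrictions agree, or
   outside [v |: W], where both values are [a0]. *)
have offH x : x \notin H -> f x = g x.
  move=> xH; rewrite -fW -gW !ffunE; have := efg x.
  rewrite !ffunE !inE; have : (x == v) = false.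
    by apply: contraNF xH => /eqP ->; rewrite inE.
  by move: xH; rewrite inE => -> -> /=.
apply/ffunP => x; case: (boolP (x \in H)); last exact: offH.
rewrite inE => xs; have us : uniq s by case/and5P: fs.
have nth_eq (k : {ffun V -> A}) : repetition e k s ->
    k x = k (nth x (drop n s) (index x (take n s))).
  case/and5P=> _ _ _ _; rewrite sz doubleK => /eqP kk.
  have szt : size (take n s) = n by rewrite size_takel // sz -addnn leq_addr.
  rewrite -[in LHS](nth_index x xs) -(nth_map x (k x)) ?index_mem // kk.
  by rewrite (nth_map x) // size_drop sz -addnn addnK -{2}szt index_mem.
rewrite (nth_eq f) // (nth_eq g) //; apply: offH; rewrite inE.
have : nth x (drop n s) (index x (take n s)) \in drop n s.
  apply: mem_nth; rewrite size_drop sz -addnn addnK.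
  rewrite -{2}(_ : size (take n s) = n) ?index_mem //.
  by rewrite size_takel // sz -addnn leq_addr.
move: us; rewrite -{1}(cat_take_drop n s) cat_uniq => /and3P[_ + _].
by move=> /hasPn h /h.
Qed.

(** A repetition in [v |: W] must pass through [v], since the coloring of [W] has none. The index
    [n] stands for half-length [n + 1], bounded by [#|V|] because paths have no repeated vertex. *)
Lemma extensions_cover v W : v \notin W ->
  extensions v W \subset colorings (v |: W) :|:
    \bigcup_(n < #|V|) [set f | has (fun s => f \in bad_extensions v W n.+1 s)
                                  (paths_through e n.+1 v)].
Proof.
move=> vW; apply/subsetP => f fE; have := fE; rewrite inE => /andP[/eqP fvW fW].
rewrite in_setU; case: (boolP (f \in _)) => //= fN; apply/bigcupP.
have [s sW fs] : exists2 s, {subset s <= v |: W} & repetition e f s.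
  apply: contrapT => ns; move/negP: fN; apply; apply/coloringsP; split=> // s sW.
  by apply/negP => fs; apply: ns; exists s.
have vs : v \in s.
  apply: contraT => vs; have sW' : {subset s <= W}.
    move=> x xs; have := sW x xs; rewrite !inE => /orP[/eqP xv|//].
    by rewrite -xv xs in vs.
  by case/coloringsP: fW => _ /(_ s sW'); rewrite repetition_reset // fs.
have [{sW fs vs}s [sW fs [n sz vs]]] : exists s,
    [/\ {subset s <= v |: W}, repetition e f s &
        exists2 n, size s = n.*2 & v \in take n s].
  have os : ~~ odd (size s) by case/and5P: fs.
  move: vs; rewrite -{1}(cat_take_drop (size s)./2 s) mem_cat => /orP[vs|vs].
    by exists s; split=> //; exists (size s)./2; rewrite ?even_halfK.
  exists (rev s); split; first by move=> x; rewrite mem_rev => /sW.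
    exact: repetition_rev.
  exists (size s)./2; first by rewrite size_rev even_halfK.
  rewrite take_rev mem_rev; congr (v \in drop _ s): vs.
  by rewrite -{2}(even_halfK os) -addnn addnK.
case: n sz vs => [|n] sz vs; first by rewrite take0 in vs.
have [us es] : uniq s /\ sorted e s by case/and5P: fs.
have nV : n < #|V|.
  have := max_card (mem s); rewrite (card_uniqP us) sz.
  by apply: leq_trans; rewrite -addnn leq_addr.
exists (Ordinal nV) => //=; rewrite inE; apply/hasP; exists s.
  exact: mem_paths_through.
rewrite inE fE fs sz eqxx vs !andbT /=; exact/allP.
Qed.

End Counting.

Local Open Scope ring_scope.

(** * The inductive lower bound on the number of colorings *)

Section LowerBound.
Context (R : realFieldType) (V A : finType) (e : rel V) (a0 : A) (D : nat).
Context (b : R).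
Hypothesis e_sym : symmetric e.
Hypothesis deg_e : forall x, (#|e x| <= D)%N.
Hypothesis b_gt0 : 0 < b.
(** The [n]-th term is the cost of paths with [2(n + 1)] vertices. Bounding partial sums avoids any
    convergence question. *)
Hypothesis b_le : forall N,
  b + \sum_(n < N) (n.+1 * D ^ n.+1.*2.-1)%:R / b ^+ n <= #|A|%:R.
Implicit Types W U : {set V}.

Local Notation count W := #|colorings e a0 W|.

(** Chains one-vertex steps. The bound [m] lets this be applied to the induction hypothesis of
    [step_ge] itself. *)
Let steps_ge m : (forall W v, (#|W| < m)%N -> v \notin W ->
    b * (count W)%:R <= (count (v |: W))%:R) ->
  forall W U, (#|U| <= m)%N -> W \subset U ->
    b ^+ #|U :\: W| * (count W)%:R <= (count U)%:R.
Proof.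
move=> step W U; move UW : #|U :\: W| => k; elim: k U UW => [|k IH] U UW Um WU.
  rewrite expr0 mul1r; suff -> : U = W by [].
  apply/eqP; rewrite eqEsubset WU andbT -setD_eq0 -cards_eq0; exact/eqP.
have /card_gt0P[u] : (0 < #|U :\: W|)%N by rewrite UW.
rewrite inE => /andP[uW uU]; rewrite -(setD1K uU).
apply: le_trans (step _ _ _ _); last 2 first.
- by apply: leq_trans Um; rewrite (cardsD1 u U) uU.
- by rewrite !inE eqxx.
rewrite exprS -mulrA ler_pM2l //; apply: IH.
- apply/eqP; rewrite -eqSS -UW [in eqbRHS](cardsD1 u) inE uW uU add1n eqSS.
  by rewrite !setDDl setUC.
- by apply: leq_trans Um; rewrite subset_leq_card ?subsetDl.
- by rewrite subsetD1 WU uW.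
Qed.

Let step_ge m W v : (#|W| < m)%N -> v \notin W ->
  b * (count W)%:R <= (count (v |: W))%:R.
Proof.
elim: m W v => // m IH W v Wm vW.
have count_bad n s :
    #|bad_extensions e a0 v W n.+1 s|%:R <= (count W)%:R / b ^+ n.
  (* A member of the set certifies that [s] is duplicate-free, of the right size and inside
     [v |: W]. *)
  have [->|[f]] := set_0Vmem (bad_extensions e a0 v W n.+1 s).
    by rewrite cards0 divr_ge0 ?exprn_ge0 ?ler0n // ltW.
  rewrite inE => /and5P[_ fs sW /eqP sz vs].
  set H := [set x in take n.+1 s].
  rewrite ler_pdivlMr ?exprn_gt0 // mulrC.
  apply: (@le_trans _ _ (b ^+ n * (count (W :\: H))%:R)).
    by rewrite ler_pM2l ?exprn_gt0 // ler_nat card_bad_extensions.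
  have us : uniq s by case/and5P: fs.
  have -> : n = #|W :\: (W :\: H)|.
    (* Of the [n + 1] vertices of [H], all but [v] lie in [W]; hence the exponent [n]. *)
    have -> : W :\: (W :\: H) = H :\ v.
      apply/setP => x; rewrite !inE negb_and negbK.
      case xs : (x \in take n.+1 s); last by rewrite andbF /= andNb.
      rewrite /= andbT.
      have := allP sW x (mem_take xs); rewrite !inE.
      by case: eqP => [->|_ /= ->] //=; rewrite (negPf vW).
    apply/eqP; rewrite -eqSS; have := cardsD1 v H.
    rewrite [v \in H]inE vs add1n => <-.
    rewrite cardsE (card_uniqP _) ?take_uniq // size_takel //.
    by rewrite sz -addnn leq_addr.
  by apply: (steps_ge IH) => //; exact: subsetDl.
have : #|A|%:R * (count W)%:R <= (count (v |: W))%:R +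
    \sum_(n < #|V|) ((n.+1 * D ^ n.+1.*2.-1)%:R / b ^+ n) * (count W)%:R.
  rewrite -natrM; apply: (@le_trans _ _ #|extensions e a0 v W|%:R).
    by rewrite ler_nat card_extensions.
  pose B (n : 'I_#|V|) := [set f | has
    (fun s => f \in bad_extensions e a0 v W n.+1 s) (paths_through e n.+1 v)].
  apply: (@le_trans _ _ ((count (v |: W))%:R + \sum_(n < #|V|) #|B n|%:R)).
    rewrite -natr_sum -natrD ler_nat.
    apply: leq_trans (subset_leq_card (extensions_cover _ e_sym vW)) _.
    apply: leq_trans (leq_card_setU _ _) _; rewrite leq_add2l.
    apply: (big_ind2 (fun (X : {set {ffun V -> A}}) k => #|X| <= k)%N) => //.
      by rewrite cards0.
    move=> X k Y l Xk Yl; apply: leq_trans (leq_card_setU _ _) _.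
    exact: leq_add.
  rewrite lerD2l ler_sum // => n _.
  apply: (@le_trans _ _ ((size (paths_through e n.+1 v))%:R *
                         ((count W)%:R / b ^+ n))); last first.
    rewrite mulrAC -mulrA ler_wpM2r ?ler_nat ?size_paths_through //.
    by rewrite divr_ge0 ?exprn_ge0 ?ler0n // ltW.
  rewrite /B; elim: (paths_through _ _ _) => [|s l IHl].
    by rewrite mul0r lern0 cards_eq0; apply/eqP/setP => f; rewrite !inE.
  set X := bad_extensions e a0 v W n.+1.
  have -> : [set f | has (fun s => f \in X s) (s :: l)] =
            X s :|: [set f | has (fun s => f \in X s) l].
    by apply/setP => f; rewrite in_setU [LHS]in_set [in RHS]in_set.
  set Y := [set f | _].
  apply: (@le_trans _ _ (#|X s| + #|Y|)%:R); first by rewrite ler_nat leq_card_setU.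
  rewrite natrD /= -add1n natrD mulrDl mul1r lerD //.
  exact: count_bad.
(* Factoring out [count W] leaves [#|A|] minus the sum, which is at least [b] by [b_le]. *)
rewrite -mulr_suml -lerBlDr -mulrBl => /(le_trans _); apply.
by rewrite ler_wpM2r ?ler0n // lerBrDr.
Qed.

Lemma count_colorings_ge W U : W \subset U ->
  b ^+ #|U :\: W| * (count W)%:R <= (count U)%:R.
Proof.
move=> WU; apply: (@steps_ge #|U|) => // W' v W'm.
by apply: (@step_ge _ W') W'm.
Qed.

Lemma count_colorings_gt0 W : (0 < count W)%N.
Proof.
rewrite -(ltr0n R); apply: lt_le_trans (count_colorings_ge (sub0set W)).
by rewrite card_colorings0 mulr1 exprn_gt0.
Qed.

End LowerBound.

(** * Extending colorings of finite sets of vertices *)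

From mathcomp Require Import finmap.
From mathcomp Require Import all_classical all_reals all_analysis.
Import numFieldNormedType.Exports.
Local Open Scope classical_set_scope.
Local Open Scope fset_scope.
Local Open Scope ring_scope.

Lemma repetition_map (U V A : eqType) (h : U -> V) (e : rel V) (c : V -> A) s :
  injective h ->
  repetition e c (map h s) = repetition (relpre h e) (c \o h) s.
Proof.
move=> h_inj; rewrite /repetition size_map map_inj_uniq // sorted_map.
by rewrite -map_take -map_drop -!map_comp; case: s.
Qed.

(** If every [T'] failed, choose a counterexample [c T'] for each and take their limit along an
    ultrafilter containing all the cones of finite sets above a given one. The limit is
    nonrepetitive and agrees on [T] with some [c T'], a contradiction. *)
Lemma nonrepetitive_compactness (V : choiceType) (A : finType) (e : rel V)
    (T : {fset V}) :
  exists2 T' : {fset V}, T `<=` T' & forall c : V -> A,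
    (forall s, {subset s <= T'} -> ~~ repetition e c s) ->
    exists2 x, nonrepetitive e x & {in T, x =1 c}.
Proof.
apply: contrapT => noT'.
have /choice[c cP] : forall T' : {fset V}, exists c : V -> A, T `<=` T' ->
    (forall s, {subset s <= T'} -> ~~ repetition e c s) /\
    ~ exists2 x, nonrepetitive e x & {in T, x =1 c}.
  move=> T'; have [TT'|] := boolP (T `<=` T'); last first.
    (* Any coloring serves when [T'] does not contain [T]; if there is none at all, [T] itself
       satisfies the claim vacuously. *)
    have [c0|] := pselect (inhabited (V -> A)); first by case: c0 => c; exists c.
    move=> ninh; exfalso; apply: noT'; exists T => // c; exfalso; apply: ninh.
    exact: inhabits.
  apply: contrapT => noc; apply: noT'; exists T' => // c cT'.
  by apply: contrapT => nox; apply: noc; exists c.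
pose F : set_system {fset V} :=
  [set P | exists T0 : {fset V}, forall T' : {fset V}, T0 `<=` T' -> P T'].
have FF : ProperFilter F.
  split; first by move=> [T0] /(_ T0 (fsubset_refl _)).
  split; first by exists fset0.
    move=> P Q [T1 P1] [T2 P2]; exists (T1 `|` T2) => T'.
    by rewrite fsubUset => /andP[/P1 ? /P2 ?]; split.
  by move=> P Q PQ [T1 P1]; exists T1 => T' /P1 /PQ.
have [U [UU FU]] := ultraFilterLemma FF.
have /choice[x xP] : forall g, exists a, U [set T' | c T' g = a].
  (* Otherwise, [A] being finite, [U] would contain the set of those [T'] for which [c T' g] avoids
     every color, which is empty. *)
  move=> g; apply: contrapT => noa.
  have : U (\bigcap_(a in [set` [fset a | a in A]]) ~` [set T' | c T' g = a]).
    apply: filter_bigI => a _.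
    have [Ua|//] := in_ultra_setVsetC [set T' | c T' g = a] UU.
    by exfalso; apply: noa; exists a.
  by case/filter_ex => T' /(_ (c T' g)); apply=> //=; rewrite inE.
have agree (s : seq V) : U [set T' | {in s, x =1 c T'}].
  elim: s => [|g s IH]; first by apply: filterS filterT => T' _ y.
  apply: filterS (filterI (xP g) IH) => T' [/= cg cs] y.
  by rewrite inE => /predU1P[->|/cs]; rewrite ?cg.
have supset (T0 : {fset V}) : U [set T' | T0 `<=` T'] by apply: FU; exists T0.
have [T' [TT' xT]] := filter_ex (filterI (supset T) (agree T)).
have [_] := cP T' TT'; apply; exists x => //.
apply/nonrepetitiveP => s.
(* Some [T1] contains [T] and [s], with [c T1] equal to [x] on [s]; a repetition of [x] along [s]
   would be one of [c T1] inside [T1]. *)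
have [T1 [[TT1 sT1] xs]] := filter_ex
  (filterI (filterI (supset T) (supset [fset y in s])) (agree s)).
rewrite (eq_in_repetition e xs); have [+ _] := cP T1 TT1; apply => y ys.
by apply: (fsubsetP sT1); rewrite inE.
Qed.

(** * Patterns of nonrepetitive colorings of a Cayley graph *)

Section Patterns.
Context (G : groupType) (S : {fset G}).

Lemma cayley_sym : symmetric (cayley S).
Proof.
move=> g h; rewrite /cayley eq_sym; congr (_ && _).
by apply: eq_existsb => s; rewrite orbC.
Qed.

(** Each generator [s] contributes at most the two neighbors [x * s] and [x / s]. *)
Lemma card_cayley (T : {fset G}) (x : T) :
  (#|relpre val (cayley S) x| <= #|` S|.*2)%N.
Proof.
pose nb := [seq (val x * s)%g | s <- S] ++ [seq (val x / s)%g | s <- S].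
have -> : (#|` S|.*2 = size nb)%N.
  by rewrite size_cat !size_map addnn.
rewrite cardE -(size_map val); apply: uniq_leq_size.
  by rewrite map_inj_uniq ?enum_uniq //; exact: val_inj.
move=> _ /mapP[y + ->]; rewrite mem_enum => /andP[_ /existsP[s /orP[]]] /eqP xy.
  by rewrite mem_cat xy map_f // (valP s).
rewrite mem_cat orbC; apply/orP; left; apply/mapP; exists (val s).
  exact: valP.
by rewrite xy mulgK.
Qed.

Lemma card_patterns_ge (R : realFieldType) (A : finType) (a0 : A) (b : R)
    (T : {fset G}) : 0 < b ->
  (forall N, b + \sum_(n < N) (n.+1 * #|` S|.*2 ^ n.+1.*2.-1)%:R / b ^+ n
               <= #|A|%:R) ->
  b ^+ #|` T| <= #|patterns (nonrepetitive_shift S (A := A)) T|%:R.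
Proof.
move=> b0 b_le; have [T' TT' T'P] := nonrepetitive_compactness A (cayley S) T.
pose e := relpre (@fsval G T') (cayley S).
have e_sym : symmetric e by move=> x y; exact: cayley_sym.
pose W := [set y : T' | val y \in T]%SET.
have cW : (#|[set: T']%SET :\: ~: W| = #|` T|)%N.
  rewrite finset.setTD finset.setCK cardfE -(card_imset _ (@fincl_inj _ _ _ TT')).
  congr #|pred_of_set _|; apply/setP => y; rewrite inE; apply/idP/imsetP.
    by move=> yT; exists [` yT] => //; exact: val_inj.
  by move=> [t _ ->] /=; exact: valP.
(* Adding the vertices of [T] to its complement in [T'] gains a factor [b ^+ #|T|] over [#|K|];
   dividing by [#|K|] will conclude. *)
have := count_colorings_ge a0 e_sym (@card_cayley T') b0 b_le
  (finset.subsetT (~: W)%SET).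
rewrite cW; set K := colorings _ _ _.
have K0 : (0 < #|K|)%N.
  exact: (count_colorings_gt0 a0 e_sym (@card_cayley T') b0 b_le).
suff le_UK : (#|colorings e a0 [set: T']%SET| <=
    #|patterns (nonrepetitive_shift S (A := A)) T| * #|K|)%N.
  move=> bU; rewrite -(ler_pM2r (x := #|K|%:R)) ?ltr0n //.
  by apply: le_trans bU _; rewrite -natrM ler_nat.
pose h (f : {ffun T' -> A}) :=
  ([ffun t : T => f (fincl TT' t)], reset a0 (~: W)%SET f).
rewrite -cardsX -(card_in_imset (f := h)).
  apply/subset_leq_card/fintype.subsetP => _ /imsetP[f fT' ->]; apply/setXP; split.
    rewrite inE; apply/asboolP.
    (* The values of [c] off [T'] are arbitrary: compactness only inspects paths inside [T']. *)
    pose c y := oapp f a0 (insub y).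
    have cf : c \o val =1 f by move=> y; rewrite /c /= valK.
    have [s sT'|x xP xc] := T'P c.
      have -> : s = map val (pmap (insub : G -> option T') s).
        rewrite pmap_filter; last by move=> y; exact: insubK.
        by apply/esym/all_filterP/allP => y /sT' yT'; rewrite isSome_insub.
      rewrite repetition_map; last exact: val_inj.
      rewrite (eq_in_repetition _ (in1W cf)).
      by case/coloringsP: fT' => _; apply => y _; rewrite inE.
    exists x => //; exists 1%g => t; rewrite mul1g ffunE xc ?(valP t) //.
    by rewrite -cf.
  apply: (reset_coloring (W := [set: T']%SET)); first exact: finset.subsetT.
  by have /coloringsP[-> _] := fT'.
move=> f g _ _ [/ffunP fgT /ffunP fgC]; apply/ffunP => y.
have [yT|yT] := boolP (val y \in T).
  have := fgT [` yT]; rewrite !ffunE; congr (f _ = g _); exact: val_inj.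
by have := fgC y; rewrite !ffunE !inE yT.
Qed.

End Patterns.

(** * Growth *)

(** The limit is the infimum of [u n / n] over positive [n]: dividing [n] by a near-optimal [k]
    compares [u n / n] with [u k / k] up to an error of order [1 / n]. *)
Lemma fekete (R : realType) (u : R^nat) :
  (forall n, 0 <= u n) -> (forall m n, u (m + n)%N <= u m + u n) ->
  cvgn (fun n => u n / n%:R).
Proof.
move=> u_ge0 u_sub; pose E := [set u n.+1 / n.+1%:R | n in setT].
have E_ge0 : lbound E 0 by move=> _ [n _ <-]; rewrite divr_ge0.
have E_inf : has_inf E.
  by split; [exists (u 1%N / 1%:R), 0%N | exists 0].
have uM q k r : u (q * k + r)%N <= q%:R * u k + u r.
  elim: q => [|q IH]; first by rewrite mul0n mul0r add0r.
  rewrite mulSn -addnA (le_trans (u_sub _ _)) // -natr1 mulrDl mul1r.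
  by rewrite addrAC [leRHS]addrC lerD2l.
apply/cvg_ex; exists (inf E); apply/cvgrPdist_le => /= eps eps0.
have [_ [m _ <-]] := inf_adherent (divr_gt0 eps0 (ltr0Sn _ 1)) E_inf.
(* [M] bounds [u] at every remainder modulo [k]. *)
set k := m.+1 => um; pose M := u 0%N + k%:R * u 1%N.
near=> n.
have n0 : (0 < n)%N by near: n; exists 1%N.
have nR : 0 < n%:R :> R by rewrite ltr0n.
have infu : inf E <= u n / n%:R.
  by apply: ge_inf; [exists 0 | exists n.-1 => //; rewrite prednK].
rewrite ler0_norm ?subr_le0 // opprB lerBlDr.
have Mn : M / n%:R <= eps / 2.
  rewrite ler_pdivrMr // mulrC -ler_pdivrMr ?divr_gt0 //.
  by near: n; exact: nbhs_infty_ger.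
have un : u n <= (n %/ k)%:R * u k + M.
  rewrite {1}(divn_eq n k); apply: le_trans (uM _ _ _) _; rewrite lerD2l.
  have := uM (n %% k)%N 1%N 0%N; rewrite muln1 addn0 => /le_trans; apply.
  rewrite addrC lerD2l ler_wpM2r // ler_nat.
  by rewrite ltnW // ltn_mod.
have : u n / n%:R <= u k / k%:R + M / n%:R.
  rewrite ler_pdivrMr // mulrDl divfK ?gt_eqF //; apply: le_trans un _.
  rewrite lerD2r -mulrA mulrC ler_wpM2l // mulrC ler_pdivlMr ?ltr0n //.
  by rewrite -natrM ler_nat leq_trunc_div.
lra.
Unshelve. all: by end_near. Qed.

Section GrowthOfShift.
Context (R : realType) (G : groupType) (A : finType) (X : set (G -> A)).
Hypothesis G_inf : infinite_set [set: G].

(** An infinite group has subsets of every finite size, so the default of [xget] never occurs. *)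
Let min_patternsP n :
  (exists2 T : {fset G}, #|` T| = n & #|patterns X T| = min_patterns X n) /\
  (forall T : {fset G}, #|` T| = n -> (min_patterns X n <= #|patterns X T|)%N).
Proof.
pose P := [pred m |
  `[< exists2 T : {fset G}, #|` T| = n & #|patterns X T| = m >]].
have exP : exists m, P m.
  have [B _ nB] := infinite_set_fset n G_inf.
  pose T := [fset x in take n B].
  exists #|patterns X T|; apply/asboolP; exists T => //.
  rewrite card_fseq undup_id ?take_uniq ?fset_uniq //.
  by rewrite size_takel.
rewrite /min_patterns; case: xgetP => [m -> //|] noM; exfalso.
case: (ex_minnP exP) => m /asboolP Pm m_min; apply: (noM m); split=> // T Tn.
by apply: m_min; apply/asboolP; exists T.
Qed.

(** For [g] outside the finite set of quotients [t1 / t2], [T1] and the translate of [T2] by [g] are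
    disjoint. A pattern on their union is determined by its two parts, and the second is a pattern
    on [T2] since appearing is invariant under translation. *)
Lemma min_patterns_sub m n :
  (min_patterns X (m + n) <= min_patterns X m * min_patterns X n)%N.
Proof.
have [[T1 T1m <-] _] := min_patternsP m; have [[T2 T2n <-] _] := min_patternsP n.
have [g gT] : exists g, [disjoint T1 & [fset (g * t)%g | t in T2]]%fset.
  pose Q := [fset (t1 / t2)%g | t1 in T1, t2 in T2].
  have [g gQ] : exists g, g \notin Q.
    apply: contrapT => noG; apply: G_inf.
    apply: (sub_finite_set _ (finite_fset Q)) => g _ /=.
    by apply: contrapT => gQ; apply: noG; exists g; apply/negP.
  exists g; apply/fdisjointP => x xT1; apply: contra gQ => /imfsetP[t /= tT2 xE].
  by apply/imfset2P; exists x => //; exists t => //; rewrite xE mulgK.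
set gT2 := [fset _ | _ in T2] in gT.
have cT : #|` (T1 `|` gT2)| = (m + n)%N.
  rewrite cardfsU (eqP gT) cardfs0 subn0 T1m card_imfset ?T2n //.
  exact: mulgI.
apply: leq_trans ((min_patternsP _).2 _ cT) _.
have gT2P (t : T2) : (g * val t)%g \in T1 `|` gT2.
  by rewrite inE orbC; apply/orP; left; apply: in_imfset; exact: valP.
pose h (p : {ffun (T1 `|` gT2) -> A}) : {ffun T1 -> A} * {ffun T2 -> A} :=
  ([ffun t => p (fincl (fsubsetUl T1 gT2) t)],
   [ffun t => p (FSetSub (gT2P t))]).
rewrite -cardsX -(card_in_imset (f := h)).
  apply/subset_leq_card/fintype.subsetP => _ /imsetP[p + ->]; rewrite inE => /asboolP.
  move=> [x Xx [k kp]]; apply/setXP; split; rewrite inE; apply/asboolP.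
    by exists x => //; exists k => t; rewrite ffunE -kp.
  by exists x => //; exists (k * g)%g => t; rewrite ffunE -kp /= mulgA.
move=> p q _ _ [/ffunP pq1 /ffunP pq2]; apply/ffunP => y.
have := valP y; rewrite inE => /orP[yT1|/imfsetP[t /= tT2 yE]].
  have := pq1 [` yT1]; rewrite !ffunE; congr (p _ = q _); exact: val_inj.
have := pq2 [` tT2]; rewrite !ffunE; congr (p _ = q _); exact: val_inj.
Qed.

Lemma growth_ge (b : R) : 0 < b ->
  (forall T : {fset G}, b ^+ #|` T| <= #|patterns X T|%:R) ->
  cvgn (growth_seq R X) /\ b <= growth R X.
Proof.
move=> b0 b_le.
have min_ge n : b ^+ n <= (min_patterns X n)%:R.
  by have [[T <- <-] _] := min_patternsP n.
have min_gt0 n : 0 < (min_patterns X n)%:R :> R.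
  by apply: lt_le_trans (min_ge n); rewrite exprn_gt0.
(* Positivity excludes the special value of the power at base [0]; the logarithms are then
   subadditive. *)
have gsE : growth_seq R X =
    (fun n => expR (ln (min_patterns X n)%:R / n%:R)).
  by apply/funext => n; rewrite /growth_seq /powR gt_eqF // mulrC.
have gs_cvg : cvgn (growth_seq R X).
  have /cvg_ex[l ul] : cvgn (fun n => ln (min_patterns X n)%:R / n%:R : R).
    apply: fekete => [n|m n].
      by rewrite ln_ge0 // ler1n -(ltr0n R).
    rewrite -lnM ?posrE // ler_ln ?posrE ?mulr_gt0 // -natrM ler_nat.
    exact: min_patterns_sub.
  apply/cvg_ex; exists (expR l); rewrite gsE.
  by apply: continuous_cvg ul; exact: continuous_expR.
split=> //; apply: limr_ge => //; near=> n.
have n0 : (n%:R : R) != 0.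
  by rewrite pnatr_eq0 -lt0n; near: n; exists 1%N.
have bn_ge0 : 0 <= b ^+ n by rewrite exprn_ge0 // ltW.
have -> : b = (b ^+ n) `^ n%:R^-1.
  by rewrite -powR_mulrn ?(ltW b0) // -powRrM mulfV // powRr1 // ltW.
by rewrite ge0_ler_powR ?nnegrE ?invr_ge0.
Unshelve. all: by end_near. Qed.

End GrowthOfShift.

(** * The numerical condition on [b] *)

Lemma sum_succ_geometric_le (R : realFieldType) (q : R) N : 0 <= q < 1 ->
  \sum_(n < N) n.+1%:R * q ^+ n <= ((1 - q) ^+ 2)^-1.
Proof.
move=> /andP[q0 q1]; have q1' : 0 < 1 - q by rewrite subr_gt0.
rewrite -[leRHS]mul1r ler_pdivlMr ?exprn_gt0 //.
have -> : (\sum_(n < N) n.+1%:R * q ^+ n) * (1 - q) ^+ 2 =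
          1 - q ^+ N * (1 + N%:R * (1 - q)).
  elim: N => [|N IH]; first by rewrite big_ord0 expr0; ring.
  by rewrite big_ord_recr /= mulrDl IH [q ^+ N.+1]exprS -natr1; ring.
by rewrite gerBl mulr_ge0 ?exprn_ge0 // addr_ge0 // mulr_ge0 // ltW.
Qed.

(* With [t = s ^ (1/3)] and [b = 4 t^6 + 12 t^5] the ratio [4 s^2 / b] is
   [t / (t + 3)], so the series sums to [2 t^3 (t + 3)^2 / 9 <= 4 t^5]. *)
Lemma path_weight_le (R : realFieldType) (t : R) (s N : nat)
    (b := 4 * t ^+ 6 + 12 * t ^+ 5) :
  1 <= t -> s%:R = t ^+ 3 ->
  b + \sum_(n < N) (n.+1 * s.*2 ^ n.+1.*2.-1)%:R / b ^+ n <=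
    4 * t ^+ 6 + 16 * t ^+ 5.
Proof.
move=> t1 st; have t0 : 0 < t by apply: lt_le_trans t1.
have t30 : 0 < t + 3 by lra.
have bE : b = 4 * t ^+ 5 * (t + 3) by rewrite /b; ring.
suff : \sum_(n < N) (n.+1 * s.*2 ^ n.+1.*2.-1)%:R / b ^+ n <= 4 * t ^+ 5.
  by rewrite /b; lra.
have -> : \sum_(n < N) (n.+1 * s.*2 ^ n.+1.*2.-1)%:R / b ^+ n =
    2 * t ^+ 3 * \sum_(n < N) n.+1%:R * (t / (t + 3)) ^+ n.
  rewrite mulr_sumr; apply: eq_bigr => n _.
  have -> : t / (t + 3) = (2 * t ^+ 3) ^+ 2 / b.
    by rewrite bE; field; rewrite !gt_eqF.
  have s2 : s.*2%:R = 2 * t ^+ 3 by rewrite -mul2n natrM st.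
  rewrite doubleS /= expnS !natrM natrX s2 -mul2n exprM expr_div_n; ring.
apply: (@le_trans _ _ (2 * t ^+ 3 * ((t + 3) ^+ 2 / 9))).
  rewrite ler_pM2l ?mulr_gt0 ?exprn_gt0 //.
  have -> : (t + 3) ^+ 2 / 9 = ((1 - t / (t + 3)) ^+ 2)^-1.
    by field; rewrite !gt_eqF //; lra.
  apply: sum_succ_geometric_le.
  by rewrite divr_ge0 ?ltW //= ltr_pdivrMr // mul1r; lra.
have -> : 4 * t ^+ 5 = 2 * t ^+ 3 * (2 * t ^+ 2) by ring.
(* Since [t + 3 <= 4 t] for [t >= 1], the left side is at most [16 t^2 / 9]. *)
by rewrite ler_pM2l ?mulr_gt0 ?exprn_gt0 //; nra.
Qed.

Theorem lemma16 (R : realType) (G : groupType) (S : {fset G}) (A : finType)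
    (G_countable : countable [set: G])
    (S_neq0 : S != fset0)
    (S_gen : generated_by S)
    (card_A : #|A|%:Z =
       Num.ceil (4 * #|` S|%:R ^+ 2 + 16 * (#|` S|%:R : R) `^ (5 / 3))) :
  (exists c : G -> A, nonrepetitive (cayley S) c) /\
  (infinite_set [set: G] -> amenable R G ->
     cvg (growth_seq R (nonrepetitive_shift S (A := A)) @ \oo) /\
     4 * #|` S|%:R ^+ 2 + 12 * (#|` S|%:R : R) `^ (5 / 3)
       <= growth R (nonrepetitive_shift S (A := A))).
Proof.
set s := #|` S| in card_A *.
have s1 : 1 <= s%:R :> R by rewrite ler1n cardfs_gt0.
(* With the cube root of [s] as variable, all exponents become integers. *)
pose t : R := s%:R `^ 3^-1.
have t1 : 1 <= t.
  have <- : 1 `^ 3^-1 = 1 :> R by rewrite powR1.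
  by rewrite ge0_ler_powR ?nnegrE ?invr_ge0.
have tn n : t ^+ n = s%:R `^ (n%:R / 3).
  by rewrite -powR_mulrn ?powR_ge0 // -powRrM mulrC.
have st : s%:R = t ^+ 3 by rewrite tn mulfV ?powRr1 ?(le_trans _ s1).
rewrite -(tn 5) in card_A *; rewrite st -exprM in card_A *.
set b := _ + 12 * _.
have b0 : 0 < b by rewrite addr_gt0 ?mulr_gt0 ?exprn_gt0 ?(lt_le_trans _ t1).
have b_le N :
    b + \sum_(n < N) (n.+1 * s.*2 ^ n.+1.*2.-1)%:R / b ^+ n <= #|A|%:R.
  apply: le_trans (path_weight_le N t1 st) _.
  by rewrite -[leRHS]/(#|A|%:Z%:~R) card_A ceil_ge.
(* The empty sum in [b_le] already gives [b <= #|A|]. *)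
have [a0 _] : exists a : A, a \in A.
  apply/card_gt0P; rewrite -(ltr0n R); apply: lt_le_trans (b_le 0%N).
  by rewrite big_ord0 addr0.
have patterns_ge T := card_patterns_ge a0 T b0 b_le.
split; last by move=> G_inf _; exact: growth_ge.
(* A pattern on the empty set exists only if some coloring of the whole group is nonrepetitive. *)
have : (0 < #|patterns (nonrepetitive_shift S (A := A)) fset0|)%N.
  rewrite -(ltr0n R); apply: lt_le_trans (patterns_ge fset0).
  by rewrite exprn_gt0.
by move=> /card_gt0P[p]; rewrite inE => /asboolP[c cX _]; exists c.
Qed.
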